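(* Let $\bar{\mathbf p}=(\bar p_1,\ldots,\bar p_L)^\top>\mathbf 0$ be a given positive vector. Then the image $\gamma([\mathbf 0,\bar{\mathbf p}])$ of the box $[\mathbf 0,\bar{\mathbf p}]=\{\mathbf p\in\mathbb R^L:\ 0\le p_l\le\bar p_l\ \forall l\}$ under the map $\gamma$ is exactly the set of all $\boldsymbol\gamma\in\mathbb R_+^L$ satisfying $$\rho\left(\mathrm{diag}(\boldsymbol\gamma)\left(F+\tfrac{1}{\bar p_l}\mathbf v\mathbf e_l^\top\right)\right)\le 1\quad\text{for } l=1,\ldots,L.$$ In particular, any $\boldsymbol\gamma\in\mathbb R_+^L$ satisfying these conditions satisfies $\boldsymbol\gamma\le\bar{\boldsymbol\gamma}=(\bar\gamma_1,\ldots,\bar\gamma_L)^\top$ (entrywise), where $\bar\gamma_l=\bar p_l/v_l$ for $l=1,\ldots,L$.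
   Context: $F=[f_{ij}]\in\mathbb R^{L\times L}$ is a fixed matrix with zero diagonal entries and positive off-diagonal entries, and $\mathbf v=(v_1,\ldots,v_L)^\top$ is a fixed vector with all entries positive. The map $\gamma:\mathbb R_+^L\to\mathbb R_+^L$ is $\gamma_l(\mathbf p)=\dfrac{p_l}{(F\mathbf p)_l+v_l}$, $l=1,\ldots,L$. $\mathbb R_+^L$ is the set of entrywise nonnegative vectors, $\rho$ denotes spectral radius, $\mathrm{diag}(\mathbf y)$ is the diagonal matrix with diagonal $\mathbf y$, and $\mathbf e_l$ is the $l$-th standard basis vector of $\mathbb R^L$. *)

(* Defs.v *)
From mathcomp Require Import all_boot all_order all_algebra.
From mathcomp Require Import classical_sets reals.
From mathcomp.real_closed Require Import complex.

Set Implicit Arguments.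
Unset Strict Implicit.
Unset Printing Implicit Defensive.

Import Order.TTheory GRing.Theory Num.Theory.

Local Open Scope ring_scope.
Local Open Scope classical_set_scope.

(* The eigenvalues are the complex ones, [normc] being the R-valued modulus on
   R[i].  The set of moduli is finite, and nonempty when 0 < n, so [sup] is a
   maximum; for n = 0 the value is [sup set0 = 0]. *)
Definition spectral_radius (R : realType) (n : nat) (A : 'M[R]_n) : R :=
  sup [set ComplexField.Normc.normc z | z in
        [set z : R[i] | eigenvalue (map_mx (real_complex R) A) z]].

Definition nonneg_vec (R : realType) (L : nat) : set 'cV[R]_L :=
  [set y | forall l, 0 <= y l 0].

Definition box0 (R : realType) (L : nat) (pbar : 'cV[R]_L) : set 'cV[R]_L :=
  [set p | forall l, 0 <= p l 0 <= pbar l 0].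

Definition sinr (R : realType) (L : nat) (F : 'M[R]_L) (v p : 'cV[R]_L) :
    'cV[R]_L :=
  \col_l (p l 0 / ((F *m p) l 0 + v l 0)).

(* [delta_mx 0 l : 'rV_L] is the transpose of the l-th standard basis column. *)
Definition power_constraint_mx (R : realType) (L : nat) (F : 'M[R]_L)
    (v pbar y : 'cV[R]_L) (l : 'I_L) : 'M[R]_L :=
  diag_mx y^T *m (F + (pbar l 0)^-1 *: (v *m delta_mx 0 l)).

(* Main.v *)
Require Import Defs.
From mathcomp Require Import all_boot all_order all_algebra.
From mathcomp Require Import classical_sets reals.
From mathcomp Require boolp.
From mathcomp.real_closed Require Import complex.
From mathcomp Require Import ring lra.

(** Write T(p) = diag(y)(F p + v).  As every denominator (F p)_l + v_l is
    positive, gamma(p) = y says that p is a fixed point of the order-preserving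
    map T, so the claim is that T has a fixed point in the box exactly when
    every A_l = diag(y)(F + v e_l^T / pbar_l) has spectral radius at most 1.

    If p = T(p) lies in the box, then A_l p <= T(p) = p because
    p_l / pbar_l <= 1.  For a nonnegative matrix such a subinvariant vector
    bounds the modulus of all eigenvalues by 1 ([normc_eigenvalue_le]); p may
    vanish somewhere, but the corresponding rows of A_l then vanish as well.

    Conversely, suppose that every A_l has spectral radius at most 1.  The core
    is [sub_interf_le]: any q >= 0 with q <= T(q) lies in the box.  Otherwise
    q_l > pbar_l for some l, and p = T(q) satisfies A_l p >= (1 + e) p for some
    e > 0, which forces a real eigenvalue of A_l to be at least 1 + e
    ([eigenvalue_ge_of_super], a weak form of the Perron-Frobenius theorem).
    So the set of all q >= 0 with q <= T(q) is bounded, and its coordinatewise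
    supremum is a fixed point by Tarski's argument ([interf_fixpoint]).

    The weak Perron-Frobenius theorem is obtained without compactness: the
    infimum of the t for which some x >= 0 satisfies A x < t x in every
    coordinate is an eigenvalue, since otherwise solving (t - A) x = 1 at this
    infimum would push it further down. *)

Set Implicit Arguments.
Unset Strict Implicit.
Unset Printing Implicit Defensive.

Import Order.TTheory GRing.Theory Num.Theory.

Local Open Scope ring_scope.
Local Open Scope classical_set_scope.

(** * Nonnegative matrices *)

Lemma mulmx_ge0 (R : realType) (n : nat) (A : 'M[R]_n) (x : 'cV[R]_n) :
  (forall i j, 0 <= A i j) -> (forall i, 0 <= x i 0) ->
  forall i, 0 <= (A *m x) i 0.
Proof. by move=> A0 x0 i; rewrite mxE sumr_ge0// => j _; rewrite mulr_ge0. Qed.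

Lemma ler_mulmx (R : realType) (n : nat) (A : 'M[R]_n) (x z : 'cV[R]_n) :
  (forall i j, 0 <= A i j) -> (forall i, x i 0 <= z i 0) ->
  forall i, (A *m x) i 0 <= (A *m z) i 0.
Proof. by move=> A0 xz i; rewrite !mxE ler_sum// => j _; rewrite ler_wpM2l. Qed.

(** A finite family is dominated by any positive family after scaling: this
    supplies every small constant below, in place of minima over indices. *)
Lemma scale_lt (R : realType) (n : nat) (x d : 'I_n -> R) :
  (forall i, 0 < d i) ->
  exists2 e, 0 < e & forall i, e * `|x i| < d i.
Proof.
move=> d0; pose S := 1 + \sum_i `|x i| / d i.
have q0 i : 0 <= `|x i| / d i by rewrite divr_ge0// ltW.
have S0 : 0 < S by rewrite ltr_wpDr// sumr_ge0.
exists S^-1; first by rewrite invr_gt0.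
move=> i; rewrite mulrC ltr_pdivrMr// -ltr_pdivrMl// mulrC.
rewrite /S (bigD1 i)//= addrCA ltrDl ltr_wpDr// sumr_ge0//.
Qed.

(** A strict supersolution x makes t - A inverse-positive.  Such an x is
    positive, and if z had a negative entry then, at an index i minimizing
    z_i / x_i = r < 0, the bound z >= r x would give
    t z_i >= (A z)_i >= r (A x)_i > r t x_i = t z_i. *)
Lemma nonneg_of_strict_super (R : realType) (n : nat) (A : 'M[R]_n) (t : R)
    (x z : 'cV[R]_n) :
  (forall i j, 0 <= A i j) -> (forall i, 0 <= x i 0) ->
  (forall i, (A *m x) i 0 < t * x i 0) ->
  (forall i, (A *m z) i 0 <= t * z i 0) ->
  forall i, 0 <= z i 0.
Proof.
move=> A0 x0 Ax Az i0; rewrite leNgt; apply/negP => zi0.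
have xp i : 0 < x i 0.
  rewrite lt_neqAle x0 andbT eq_sym; apply/eqP => xi.
  have := le_lt_trans (mulmx_ge0 A0 x0 i) (Ax i).
  by rewrite xi mulr0 ltxx.
case: (@Order.TotalTheory.arg_minP _ _ _ i0 xpredT (fun i => z i 0 / x i 0)) => // i _ imin.
set r := z i 0 / x i 0 in imin.
have r0 : r < 0.
  by rewrite (le_lt_trans (imin i0 isT))// pmulr_llt0// invr_gt0.
have zr j : (r *: x) j 0 <= z j 0 by rewrite mxE -ler_pdivlMr// imin.
have := ler_mulmx A0 zr i.
rewrite -scalemxAr mxE => h; have := le_trans h (Az i).
have -> : z i 0 = r * x i 0 by rewrite /r divfK// gt_eqF.
by rewrite mulrCA leNgt ltr_nM2l// Ax.
Qed.

(** Lower Collatz-Wielandt bound.  The eigenvalue is the infimum of the set T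
    of those t that admit a strict supersolution.  By inverse positivity,
    p shows that s is a lower bound of T.  If inf T were not an eigenvalue,
    (inf T - A) x = 1 would have a solution; it is nonnegative by inverse
    positivity at a nearby t in T, and it is then still a strict supersolution
    slightly below inf T. *)
Lemma eigenvalue_ge_of_super (R : realType) (n : nat) (A : 'M[R]_n) (s : R)
    (p : 'cV[R]_n) :
  (forall i j, 0 <= A i j) -> (forall i, 0 <= p i 0) ->
  (exists i, 0 < p i 0) -> (forall i, s * p i 0 <= (A *m p) i 0) ->
  exists2 t, s <= t & eigenvalue A t.
Proof.
move=> A0 p0 [l pl] Ap.
pose T := [set t : R | exists x : 'cV[R]_n,
  (forall i, 0 <= x i 0) /\ (forall i, (A *m x) i 0 < t * x i 0)].
have Tlb t : T t -> s <= t.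
  move=> [x [x0 Ax]]; rewrite leNgt; apply/negP => ts.
  have /(_ l) : forall i, 0 <= (- p) i 0.
    apply: (nonneg_of_strict_super A0 x0 Ax) => i.
    rewrite mulmxN !mxE mulrN lerN2; apply: le_trans (ler_wpM2r (p0 i) (ltW ts)) _.
    by have := Ap i; rewrite mxE.
  by rewrite mxE oppr_ge0 leNgt pl.
have T0 : T !=set0.
  (* Any t above all row sums belongs to T, with x the all-ones vector. *)
  exists (1 + \sum_i \sum_j A i j); exists (const_mx 1); split => [i|i].
    by rewrite mxE.
  rewrite !mxE mulr1; under eq_bigr do rewrite mxE mulr1.
  rewrite [X in _ < _ + X](bigD1 i)//= addrCA ltrDl ltr_wpDr// sumr_ge0// => k _.
  by rewrite sumr_ge0.
have hT : has_inf T by split=> //; exists s => t /Tlb.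
exists (inf T); first exact: lb_le_inf.
apply: contraT; rewrite /eigenvalue /eigenspace negbK kermx_eq0 row_free_unit => U.
pose x := invmx (A - (inf T)%:M) *m (const_mx (- 1) : 'cV[R]_n).
have Ax i : (A *m x) i 0 = inf T * x i 0 - 1.
  have shiftE (z : 'cV[R]_n) t : ((A - t%:M) *m z) i 0 = (A *m z) i 0 - t * z i 0.
    by rewrite mulmxBl mul_scalar_mx; move: (A *m z) => w; rewrite !mxE.
  have : ((A - (inf T)%:M) *m x) i 0 = - 1 by rewrite mulKVmx// mxE.
  by rewrite shiftE => /eqP; rewrite subr_eq addrC => /eqP.
have [e e0 ex] : exists2 e, 0 < e & forall i, e * `|x i 0| < 1.
  exact: (@scale_lt _ _ (fun i => x i 0) (fun=> 1)).
have [t Tt te] := inf_adherent e0 hT.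
have inft : inf T <= t by apply: ge_inf => //; exact: hT.2.
have x0 i : 0 <= x i 0.
  (* A x = (inf T) x - 1 <= t x because |(t - inf T) x_i| < 1. *)
  case: Tt => y [y0 Ay]; apply: (nonneg_of_strict_super A0 y0 Ay) => {}i.
  rewrite Ax -subr_ge0.
  have ti : 0 <= t - inf T by rewrite subr_ge0.
  have xN : 0 <= x i 0 + `|x i 0| by rewrite -lerBlDl sub0r -normrN ler_norm.
  have le1 : (t - inf T) * `|x i 0| <= e * `|x i 0|.
    by rewrite ler_wpM2r//; lra.
  by have := ex i; have := mulr_ge0 ti xN; lra.
have : inf T <= inf T - e.
  apply: ge_inf; first exact: hT.2.
  exists x; split => // i; rewrite Ax; have := ex i; rewrite ger0_norm//; lra.
by move=> ?; lra.
Qed.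

(** * Spectral radius *)

Lemma normc_sum (R : realType) (I : Type) (r : seq I) (f : I -> R[i]) :
  ComplexField.Normc.normc (\sum_(i <- r) f i) <=
  \sum_(i <- r) ComplexField.Normc.normc (f i).
Proof.
elim/big_ind2: _ => [||//]; first by rewrite ComplexField.Normc.normc0.
move=> a b c d ab cd; apply: le_trans (lerD ab cd).
exact: (@le_normcD R).
Qed.

Lemma normc_real (R : realType) (a : R) :
  ComplexField.Normc.normc (real_complex R a) = `|a|.
Proof. by rewrite /ComplexField.Normc.normc /= expr0n addr0 sqrtr_sqr. Qed.

Lemma normc_ge0 (R : realType) (z : R[i]) : 0 <= ComplexField.Normc.normc z.
Proof. by case: z => a b; exact: sqrtr_ge0. Qed.

(** Upper Collatz-Wielandt bound.  For a left eigenvector w, pairing |w| with p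
    gives |z| W <= s W, where W is the sum of |w_i| p_i.  If W = 0, then w
    vanishes on the support of p while the other rows of A are zero, so
    w A = 0 and z = 0. *)
Lemma normc_eigenvalue_le (R : realType) (n : nat) (A : 'M[R]_n) (s : R)
    (p : 'cV[R]_n) (z : R[i]) :
  (forall i j, 0 <= A i j) -> (forall i, 0 <= p i 0) -> 0 <= s ->
  (forall i, (A *m p) i 0 <= s * p i 0) ->
  (forall i, p i 0 = 0 -> forall j, A i j = 0) ->
  eigenvalue (map_mx (real_complex R) A) z ->
  ComplexField.Normc.normc z <= s.
Proof.
move=> A0 p0 s0 Ap Arow /eigenvalueP[w wA w0].
pose N := @ComplexField.Normc.normc R.
pose W := \sum_i N (w 0 i) * p i 0.
have wE j : z * w 0 j = \sum_i w 0 i * real_complex R (A i j).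
  by have /rowP/(_ j) := wA; rewrite !mxE => <-; apply: eq_bigr => i _; rewrite mxE.
have WT i : 0 <= N (w 0 i) * p i 0 by rewrite mulr_ge0// normc_ge0.
have NW : N z * W <= s * W.
  rewrite /W !mulr_sumr.
  apply: (@le_trans _ _ (\sum_j \sum_i N (w 0 i) * A i j * p j 0)).
    apply: ler_sum => j _.
    rewrite mulrA -ComplexField.Normc.normcM wE -mulr_suml ler_wpM2r//.
    apply: le_trans (normc_sum _ _) _; apply: ler_sum => i _.
    by rewrite ComplexField.Normc.normcM normc_real ger0_norm.
  rewrite exchange_big; apply: ler_sum => i _ /=.
  under eq_bigr do rewrite -mulrA.
  rewrite -mulr_sumr mulrCA ler_wpM2l ?normc_ge0//.
  by have := Ap i; rewrite mxE.
have [W0|W0] := eqVneq W 0; last first.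
  by move: NW; rewrite ler_pM2r// lt_neqAle eq_sym W0 sumr_ge0.
have z0 : z *: w = 0.
  apply/rowP => j; rewrite !mxE wE big1// => i _.
  have /allP/(_ i) : all (fun i => N (w 0 i) * p i 0 == 0) (index_enum 'I_n).
    by move/eqP: W0; rewrite psumr_eq0.
  rewrite mem_index_enum mulf_eq0 => /(_ isT)/orP[/eqP/ComplexField.Normc.eq0_normc ->|].
    by rewrite mul0r.
  by move=> /eqP/Arow ->; rewrite rmorph0 mulr0.
move/eqP: z0; rewrite scaler_eq0 (negPf w0) orbF => /eqP ->.
by rewrite ComplexField.Normc.normc0.
Qed.

Lemma spectral_radius_le (R : realType) (n : nat) (A : 'M[R]_n) (s : R)
    (p : 'cV[R]_n) :
  (forall i j, 0 <= A i j) -> (forall i, 0 <= p i 0) -> 0 <= s ->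
  (forall i, (A *m p) i 0 <= s * p i 0) ->
  (forall i, p i 0 = 0 -> forall j, A i j = 0) ->
  spectral_radius A <= s.
Proof.
move=> A0 p0 s0 Ap Arow; rewrite /spectral_radius; set S := (X in sup X).
have [->|S0] := boolp.pselect (S = set0); first by rewrite sup0.
apply: ge_sup; first by apply/set0P/eqP.
by move=> _ [z zA <-]; exact: normc_eigenvalue_le zA.
Qed.

(** The content is that the set of moduli is bounded above, as the supremum of
    an unbounded set is a default value; the all-ones vector and the sum of all
    entries of A provide a bound. *)
Lemma eigenvalue_le_spectral_radius (R : realType) (n : nat) (A : 'M[R]_n)
    (t : R) :
  (forall i j, 0 <= A i j) -> eigenvalue A t -> t <= spectral_radius A.
Proof.
move=> A0 At; apply: le_trans (ler_norm t) _; rewrite -normc_real.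
apply: ub_le_sup; last first.
  exists (real_complex R t) => //=.
  by move: At; rewrite !eigenvalue_root_char -map_char_poly fmorph_root.
exists (\sum_i \sum_j A i j) => _ [z zA <-].
have S0 : 0 <= \sum_i \sum_j A i j by rewrite !sumr_ge0// => i _; rewrite sumr_ge0.
apply: (@normc_eigenvalue_le _ _ _ _ (const_mx 1) _ A0 _ S0 _ _ zA) => i.
- by rewrite mxE.
- rewrite !mxE mulr1; under eq_bigr do rewrite mxE mulr1.
  by rewrite [leRHS](bigD1 i)//= lerDl sumr_ge0// => k _; rewrite sumr_ge0.
- by rewrite mxE => /eqP; rewrite oner_eq0.
Qed.

(** * The interference map *)

(** For y >= 0, v > 0 and F >= 0, the nonnegative fixed points are the power
    vectors p >= 0 with [sinr F v p = y]. *)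
Definition interf (R : realType) (n : nat) (F : 'M[R]_n) (v y p : 'cV[R]_n) :
    'cV[R]_n :=
  \col_i (y i 0 * ((F *m p) i 0 + v i 0)).

Lemma power_constraint_mxE (R : realType) (n : nat) (F : 'M[R]_n)
    (v pbar y : 'cV[R]_n) (l i j : 'I_n) :
  power_constraint_mx F v pbar y l i j =
  y i 0 * (F i j + (pbar l 0)^-1 * (v i 0 * (j == l)%:R)).
Proof. by rewrite /power_constraint_mx mul_diag_mx !mxE big_ord1 !mxE eqxx. Qed.

(** The matrix acts as [interf], except that the noise v is weighted by
    p_l / pbar_l; comparing this weight with 1 relates the spectral condition
    to the power constraint on coordinate l. *)
Lemma power_constraint_mulmxE (R : realType) (n : nat) (F : 'M[R]_n)
    (v pbar y p : 'cV[R]_n) (l i : 'I_n) :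
  (power_constraint_mx F v pbar y l *m p) i 0 =
  y i 0 * ((F *m p) i 0 + p l 0 / pbar l 0 * v i 0).
Proof.
rewrite /power_constraint_mx -mulmxA mulmxDl mul_diag_mx !mxE; congr (_ * (_ + _)).
rewrite (bigD1 l)//= big1 => [|j jl]; rewrite !mxE big_ord1 !mxE /=.
  by rewrite eqxx addr0 mulr1 mulrAC [_ * p l 0]mulrC.
by rewrite (negPf jl) !mulr0 mul0r.
Qed.

Lemma power_constraint_mx_ge0 (R : realType) (n : nat) (F : 'M[R]_n)
    (v pbar y : 'cV[R]_n) (l : 'I_n) :
  (forall i j, 0 <= F i j) -> (forall i, 0 <= v i 0) ->
  (forall i, 0 <= pbar i 0) -> (forall i, 0 <= y i 0) ->
  forall i j, 0 <= power_constraint_mx F v pbar y l i j.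
Proof.
move=> F0 v0 b0 y0 i j; rewrite power_constraint_mxE.
by rewrite mulr_ge0// addr_ge0// mulr_ge0 ?invr_ge0// mulr_ge0.
Qed.

Lemma interf_homo (R : realType) (n : nat) (F : 'M[R]_n) (v y p q : 'cV[R]_n) :
  (forall i j, 0 <= F i j) -> (forall i, 0 <= y i 0) ->
  (forall i, p i 0 <= q i 0) ->
  forall i, interf F v y p i 0 <= interf F v y q i 0.
Proof.
move=> F0 y0 pq i; rewrite [leLHS]mxE [leRHS]mxE ler_wpM2l// lerD2r.
exact: ler_mulmx.
Qed.

(** If q_l > pbar_l, replace q by p = T(q) >= q, which still exceeds pbar_l at l
    and, unlike q, is controlled by the noise: p = diag(y)(F q + v) is at most
    a multiple of diag(y) v.  The surplus (p_l / pbar_l - 1) diag(y) v of A_l p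
    over p is therefore at least e p for some e > 0. *)
Lemma sub_interf_le (R : realType) (n : nat) (F : 'M[R]_n)
    (v pbar y : 'cV[R]_n) (l : 'I_n) (q : 'cV[R]_n) :
  (forall i j, 0 <= F i j) -> (forall i, 0 < v i 0) ->
  (forall i, 0 < pbar i 0) -> (forall i, 0 <= y i 0) ->
  spectral_radius (power_constraint_mx F v pbar y l) <= 1 ->
  (forall i, 0 <= q i 0) -> (forall i, q i 0 <= interf F v y q i 0) ->
  q l 0 <= pbar l 0.
Proof.
move=> F0 v0 b0 y0 rho q0 qT; rewrite leNgt; apply/negP => ql.
set p := interf F v y q in qT.
have pE i : p i 0 = y i 0 * ((F *m q) i 0 + v i 0) by rewrite mxE.
have p0 i : 0 <= p i 0 by exact: le_trans (qT i).
have pl : pbar l 0 < p l 0 by exact: lt_le_trans (qT l).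
pose d := p l 0 / pbar l 0 - 1.
have d0 : 0 < d by rewrite subr_gt0 ltr_pdivlMr// mul1r.
have [e e0 eF] : exists2 e, 0 < e &
    forall i, e * `|(F *m q) i 0 + v i 0| < d * v i 0.
  apply: (@scale_lt _ _ (fun i => (F *m q) i 0 + v i 0) (fun i => d * v i 0)) => i.
  by rewrite mulr_gt0.
have A0 := @power_constraint_mx_ge0 _ _ F v pbar y l F0
  (fun i => ltW (v0 i)) (fun i => ltW (b0 i)) y0.
have Ap i : (1 + e) * p i 0 <= (power_constraint_mx F v pbar y l *m p) i 0.
  rewrite power_constraint_mulmxE pE mulrCA ler_wpM2l//.
  have -> : p l 0 / pbar l 0 = 1 + d by rewrite /d; ring.
  have := ler_mulmx F0 qT i; have := eF i; have := ler_norm ((F *m q) i 0 + v i 0).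
  nra.
have [|t et At] := eigenvalue_ge_of_super A0 p0 _ Ap.
  by exists l; exact: lt_trans pl.
have := eigenvalue_le_spectral_radius A0 At; lra.
Qed.

(** Tarski's argument: the supremum p of the set P of all q >= 0 with q <= T(q)
    satisfies p <= T(p), so T(p) is again in P and T(p) <= p.  The bound on P,
    needed for suprema to exist, is also what puts p into the box. *)
Lemma interf_fixpoint (R : realType) (n : nat) (F : 'M[R]_n)
    (v pbar y : 'cV[R]_n) :
  (forall i j, 0 <= F i j) -> (forall i, 0 <= v i 0) -> (forall i, 0 <= y i 0) ->
  (forall q : 'cV[R]_n, (forall i, 0 <= q i 0) ->
     (forall i, q i 0 <= interf F v y q i 0) -> forall i, q i 0 <= pbar i 0) ->
  exists p : 'cV[R]_n, box0 pbar p /\ interf F v y p = p.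
Proof.
move=> F0 v0 y0 bnd.
pose P := [set q : 'cV[R]_n | (forall i, 0 <= q i 0) /\
  (forall i, q i 0 <= interf F v y q i 0)].
pose p : 'cV[R]_n := \col_i sup [set q i 0 | q in P].
have P0 : P 0.
  split=> i; first by rewrite mxE.
  by rewrite [leLHS]mxE [leRHS]mxE mulr_ge0// addr_ge0// mulmx0 mxE.
have Pp q : P q -> forall i, q i 0 <= p i 0.
  move=> Pq i; rewrite mxE; apply: ub_le_sup; last by exists q.
  by exists (pbar i 0) => _ [r [r0 rT] <-]; exact: bnd.
have p0 i : 0 <= p i 0 by have := Pp _ P0 i; rewrite mxE.
have pT i : p i 0 <= interf F v y p i 0.
  rewrite [X in X <= _]mxE; apply: ge_sup.
    by exists (0 : R); exists 0 => //; rewrite mxE.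
  move=> _ [q Pq <-]; apply: le_trans (Pq.2 i) _.
  by apply: interf_homo => //; exact: Pp.
exists p; split=> [i|]; first by rewrite p0 bnd.
apply/matrixP => i j; rewrite ord1; apply: le_anti; rewrite pT andbT.
apply: Pp; split=> k; first exact: le_trans (pT k).
exact: interf_homo.
Qed.

(** * The image of the box *)

Unset Implicit Arguments.
Set Strict Implicit.

Theorem corollary2p4 (R : realType) (L : nat) (F : 'M[R]_L) (v pbar : 'cV[R]_L)
    (hFdiag : forall i : 'I_L, F i i = 0)
    (hFoff : forall i j : 'I_L, i != j -> 0 < F i j)
    (hv : forall l : 'I_L, 0 < v l 0)
    (hpbar : forall l : 'I_L, 0 < pbar l 0) :
  sinr F v @` box0 pbar =
    [set y | nonneg_vec y /\
       forall l : 'I_L, spectral_radius (power_constraint_mx F v pbar y l) <= 1]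
  /\
  (forall y : 'cV[R]_L, nonneg_vec y ->
     (forall l : 'I_L, spectral_radius (power_constraint_mx F v pbar y l) <= 1) ->
     forall l : 'I_L, y l 0 <= pbar l 0 / v l 0).
Proof.
have F0 i j : 0 <= F i j.
  by have [->|/hFoff/ltW//] := eqVneq i j; rewrite hFdiag.
have den (p : 'cV[R]_L) : (forall i, 0 <= p i 0) -> forall i, 0 < (F *m p) i 0 + v i 0.
  by move=> p0 i; rewrite ltr_wpDl//; exact: mulmx_ge0.
(* The bound on y also follows from this, as y = gamma(p) with p <= pbar. *)
have realize y : nonneg_vec y ->
    (forall l, spectral_radius (power_constraint_mx F v pbar y l) <= 1) ->
    exists2 p, box0 pbar p & sinr F v p = y.
  move=> y0 rho.
  have [|p [pbox pT]] := @interf_fixpoint R L F v pbar y F0 (fun i => ltW (hv i)) y0.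
    by move=> q q0 qT l; exact: sub_interf_le (rho l) q0 qT.
  exists p => //; apply/matrixP => i j; rewrite ord1 mxE.
  have /matrixP/(_ i 0) := pT; rewrite mxE => <-.
  by rewrite mulfK// gt_eqF// den// => k; case/andP: (pbox k).
split; last first.
  move=> y y0 rho l; have [p pbox <-] := realize y y0 rho.
  have p0 k : 0 <= p k 0 by case/andP: (pbox k).
  rewrite mxE ler_pM ?invr_ge0// ?(ltW (den _ p0 l))//; first by case/andP: (pbox l).
  by rewrite lef_pV2 ?posrE// ?den// lerDr; exact: mulmx_ge0.
apply/seteqP; split=> [_ [p pbox <-]|y [y0 rho]]; last first.
  by have [p ? ?] := realize y y0 rho; exists p.
have p0 k : 0 <= p k 0 by case/andP: (pbox k).
have y0 : nonneg_vec (sinr F v p).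
  by move=> l; rewrite mxE divr_ge0// ltW// den.
split=> // l.
have yE i : sinr F v p i 0 * ((F *m p) i 0 + v i 0) = p i 0.
  by rewrite mxE divfK// gt_eqF// den.
apply: (@spectral_radius_le _ _ _ _ p) => //.
- by apply: power_constraint_mx_ge0 => // i; exact: ltW.
- move=> i; rewrite power_constraint_mulmxE mul1r -[leRHS]yE ler_wpM2l// lerD2l.
  rewrite -[leRHS]mul1r ler_pM2r// ler_pdivrMr// mul1r.
  by case/andP: (pbox l).
- move=> i pi j; rewrite power_constraint_mxE.
  by rewrite [sinr _ _ _ _ _]mxE pi !mul0r.
Qed.
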